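(* Let $A$ and $B$ be SMLC $*$-algebras, suppose that $B$ has the inverse square root property with data $(V_B,\vartheta)$, and let $f:A\times[0,\infty)\to B$ be a pointwise bounded asymptotic morphism (PBAM). Call a continuous function $\alpha:\mathcal U(A)\to[0,\infty)$ admissible for $f$ if for all $v\in\mathcal U(A)$ and all $t\ge\alpha(v)$ we have $f_t(v)\bullet f_t(v)^*\in V_B$ and $f_t(v)^*\bullet f_t(v)\in V_B$. Then there is a well defined homotopy class $\mathcal U(f)\in[\mathcal U(A),\mathcal U(B)]$ with representative the function $$\tilde f_\alpha:\mathcal U(A)\to\mathcal U(B),\qquad \tilde f_\alpha(v)=f_{\alpha(v)}(v)\bullet\vartheta\big(f_{\alpha(v)}(v)^*\bullet f_{\alpha(v)}(v)\big),$$ where $\alpha$ is admissible for $f$; here well defined means independent of the choice of $\alpha$. That is: there is exactly one class $\mathcal U(f)\in[\mathcal U(A),\mathcal U(B)]$ such that for every admissible $\alpha$ the map $\tilde f_\alpha$ is a continuous map $\mathcal U(A)\to\mathcal U(B)$ representing $\mathcal U(f)$.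
   Context: An SMLC $*$-algebra is a separable metrisable locally convex complex $*$-algebra with continuous multiplication and $*$-operation. Its topology is given by seminorms $|\cdot|_0,|\cdot|_1,\dots$ and by a translation invariant metric $d$; the seminorms are chosen so that $|b|_n\le|b|_{n+1}$, $|b^*|_n\le|b|_{n+1}$ and $|bb'|_n\le|b|_{n+1}|b'|_{n+1}$. No unit is assumed. Write $a\bullet b=a+b+ab$ (associative, with two-sided unit $0$), and $\mathcal U(A)=\{u\in A:u\bullet u^*=u^*\bullet u=0\}$ with the subspace topology. An element $a$ is $\bullet$-invertible if there is $a'$ with $a\bullet a'=a'\bullet a=0$. $[X,Y]$ denotes the set of homotopy classes of continuous maps $X\to Y$. Inverse square root property for a topological $*$-algebra $B$: with $B_{sad}=\{b\in B:b^*=b\}$, there are a convex open set $V_B\subset B_{sad}$ (open in $B_{sad}$) containing $0$ and a continuous function $\vartheta:V_B\to B_{sad}$ such that for all $b\in V_B$: (1) $b\bullet\vartheta(b)=\vartheta(b)\bullet b$; (2) $b\bullet(\vartheta(b)\bullet\vartheta(b))=0$; (3) $b$ is $\bullet$-invertible; and (4) $\vartheta(0)=0$. Fix such $(V_B,\vartheta)$. PBAM: a continuous function $f:A\times[0,\infty)\to B$, $(a,t)\mapsto f_t(a)$, such that (a) for all $a\in A$ and $n\in\mathbb N$ the set $\{|f_t(a)|_n:t\ge0\}$ is bounded; (b) $f$ is strongly asymptotically continuous: for all $\epsilon>0$ and $a\in A$ there are $\eta>0$ and $P\ge0$ such that for all $a'\in A$ with $d(a,a')<\eta$ and all $t\ge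 P$, $d(f_t(a),f_t(a'))<\epsilon$; and, as $t\to\infty$, for all $a,a'\in A$, $\lambda\in\mathbb C$: (c) $f_t(a)^*-f_t(a^* )\to0$; (d) $\lambda f_t(a)-f_t(\lambda a)\to0$; (e) $f_t(a)+f_t(a')-f_t(a+a')\to0$; (f) $f_t(a)f_t(a')-f_t(aa')\to0$. *)

(* Defs.v *)
(* The complex numbers are [R[i]] for [R : realType]. *)
From HB Require Import structures.
From mathcomp Require Import all_boot all_order all_algebra.
From mathcomp Require Export complex.
From mathcomp Require Import all_classical all_reals all_analysis.

Set Implicit Arguments.
Unset Strict Implicit.
Unset Printing Implicit Defensive.

Import Order.TTheory GRing.Theory Num.Theory.
Export numFieldNormedType.Exports.

Local Open Scope classical_set_scope.
Local Open Scope ring_scope.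

Reserved Notation "x ** y" (at level 40, left associativity).
Reserved Notation "x • y" (at level 50, left associativity).

(* No unit and no completeness is assumed.  The metric [sdist] is a field rather
   than a [Metric] instance because the hierarchy has no join of [Tvs] and
   [PseudoMetric].  The seminorms increase with [n], so that finite
   intersections of their balls reduce to single balls: this is the form in
   which [nbhs_snormE] says that they generate the topology. *)
HB.mixin Record Tvs_isSMLCStarAlg (R : realType) A
    & Tvs R[i] A := {
  amul : A -> A -> A ;
  star : A -> A ;
  snorm : nat -> A -> R ;
  sdist : A -> A -> R ;
  amulA : associative amul ;
  amulDl : left_distributive amul +%R ;
  amulDr : right_distributive amul +%R ;
  amulZl : forall (c : R[i]) (x y : A), amul (c *: x) y = c *: amul x y ;
  amulZr : forall (c : R[i]) (x y : A), amul x (c *: y) = c *: amul x y ;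
  starK : involutive star ;
  starD : {morph star : x y / x + y} ;
  starZ : forall (c : R[i]) (x : A), star (c *: x) = conjc c *: star x ;
  starM : forall x y : A, star (amul x y) = amul (star y) (star x) ;
  amul_continuous : continuous (fun p : A * A => amul p.1 p.2) ;
  star_continuous : continuous star ;
  sdist_eq0 : forall x y : A, sdist x y = 0 <-> x = y ;
  sdist_sym : forall x y : A, sdist x y = sdist y x ;
  sdist_triangle : forall y x z : A, sdist x z <= sdist x y + sdist y z ;
  sdist_translation : forall x y z : A, sdist (x + z) (y + z) = sdist x y ;
  nbhs_sdistE : forall (x : A) (U : set A), nbhs x U <->
    exists2 e : R, 0 < e & [set y | sdist x y < e] `<=` U ;
  separable : exists2 D : set A, countable D & dense D ;
  snorm_ge0 : forall n (x : A), 0 <= snorm n x ;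
  snormD : forall n (x y : A), snorm n (x + y) <= snorm n x + snorm n y ;
  snormZ : forall n (c : R[i]) (x : A),
    snorm n (c *: x) = Normc.normc c * snorm n x ;
  nbhs_snormE : forall (x : A) (U : set A), nbhs x U <->
    exists n (e : R), 0 < e /\ [set y | snorm n (y - x) < e] `<=` U ;
  snorm_leS : forall n (x : A), snorm n x <= snorm n.+1 x ;
  snorm_star : forall n (x : A), snorm n (star x) <= snorm n.+1 x ;
  snormM : forall n (x y : A),
    snorm n (amul x y) <= snorm n.+1 x * snorm n.+1 y
}.

#[short(type="smlcStarAlgType")]
HB.structure Definition SMLCStarAlg (R : realType) :=
  {A of Tvs_isSMLCStarAlg R A & Tvs R[i] A}.

Notation "x ** y" := (amul x y) : ring_scope.

Definition bullet (R : realType) (A : smlcStarAlgType R) (x y : A) : A :=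
  x + y + x ** y.

Notation "x • y" := (bullet x y) : ring_scope.

Definition unitaries (R : realType) (A : smlcStarAlgType R) : set A :=
  [set u | u • star u = 0 /\ star u • u = 0].
Arguments unitaries {R} A _.

Definition bullet_invertible (R : realType) (A : smlcStarAlgType R) (x : A) :=
  exists y : A, x • y = 0 /\ y • x = 0.

Definition selfadjoint (R : realType) (A : smlcStarAlgType R) : set A :=
  [set b | star b = b].
Arguments selfadjoint {R} A _.

(* [theta] is a total function, of which only the restriction to [V] matters. *)
Record inverse_sqrt_data (R : realType) (B : smlcStarAlgType R)
    (V : set B) (theta : B -> B) : Prop := InverseSqrtData {
  isd_open : exists2 O : set B, open O & V = O `&` selfadjoint B ;
  isd_convex : convex_set (V : set (convex_lmodType B)) ;
  isd_0 : V 0 ;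
  isd_continuous : {within V, continuous theta} ;
  isd_selfadjoint : forall b, V b -> selfadjoint B (theta b) ;
  isd_comm : forall b, V b -> b • theta b = theta b • b ;
  isd_inv_sqrt : forall b, V b -> b • (theta b • theta b) = 0 ;
  isd_invertible : forall b, V b -> bullet_invertible b ;
  isd_theta0 : theta 0 = 0
}.

(* [f t a] is f_t(a); only the values at [0 <= t] matter. *)
Record pbam (R : realType) (A B : smlcStarAlgType R) (f : R -> A -> B) : Prop :=
  Pbam {
  pbam_continuous : {within [set p : A * R | 0 <= p.2],
    continuous (fun p : A * R => f p.2 p.1)} ;
  pbam_bounded : forall (a : A) (n : nat),
    exists M : R, forall t : R, 0 <= t -> snorm n (f t a) <= M ;
  pbam_asymptotic_continuity : forall (e : R) (a : A), 0 < e ->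
    exists eta P : R, [/\ 0 < eta, 0 <= P &
      forall a' : A, sdist a a' < eta ->
      forall t : R, P <= t -> sdist (f t a) (f t a') < e] ;
  pbam_star : forall a : A,
    star (f t a) - f t (star a) @[t --> +oo] --> (0 : B) ;
  pbam_scale : forall (c : R[i]) (a : A),
    c *: f t a - f t (c *: a) @[t --> +oo] --> (0 : B) ;
  pbam_add : forall a a' : A,
    f t a + f t a' - f t (a + a') @[t --> +oo] --> (0 : B) ;
  pbam_mul : forall a a' : A,
    f t a ** f t a' - f t (a ** a') @[t --> +oo] --> (0 : B)
}.

Definition homotopic (R : realType) (X Y : topologicalType)
    (g h : continuousType X Y) : Prop :=
  exists H : X * (`[0, 1]%classic : set R) -> Y, [/\ continuous H,
    forall x t, set_val t = 0 -> H (x, t) = g x &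
    forall x t, set_val t = 1 -> H (x, t) = h x].

(* [X, Y], its elements being the equivalence classes of [homotopic]. *)
Definition homotopy_classes (R : realType) (X Y : topologicalType) :
    set (set (continuousType X Y)) :=
  [set c | exists g : continuousType X Y, c = [set h | homotopic R g h]].
Arguments homotopy_classes R X Y _ : clear implicits.

Definition admissible (R : realType) (A B : smlcStarAlgType R) (V : set B)
    (f : R -> A -> B) (alpha : unitaries A -> R) : Prop :=
  [/\ continuous alpha, forall v, 0 <= alpha v &
    forall (v : unitaries A) (t : R), alpha v <= t ->
      V (f t (set_val v) • star (f t (set_val v))) /\
      V (star (f t (set_val v)) • f t (set_val v))].

Definition ftilde (R : realType) (A B : smlcStarAlgType R) (theta : B -> B)
    (f : R -> A -> B) (alpha : unitaries A -> R) (v : unitaries A) : B :=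
  let w := f (alpha v) (set_val v) in w • theta (star w • w).

(* Main.v *)
Require Import Defs.
From mathcomp Require Import all_boot all_order all_algebra.
From mathcomp Require Import all_classical all_reals all_analysis.
From mathcomp Require Import lra.
Set Implicit Arguments.
Unset Strict Implicit.
Unset Printing Implicit Defensive.
Import Order.TTheory GRing.Theory Num.Theory.
Local Open Scope classical_set_scope.
Local Open Scope ring_scope.

(** Write [w := f_t(v)] for a unitary [v].  Since [v • v^* = v^* • v = 0] and
    [f] is asymptotically a *-homomorphism, [w • w^*] and [w^* • w] tend to [0]
    as [t] grows.  The convergence is uniform for arguments near [v]: by strong
    asymptotic continuity [f_t(x) - f_t(v)] tends to [0] when [x] tends to [v]
    and [t] to infinity simultaneously, and pointwise boundedness keeps the
    products under control ([pbam_cvg0_unitary]).  Both elements are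
    selfadjoint, and [V] is a neighbourhood of [0] among the selfadjoint
    elements, so every unitary has a neighbourhood on which a constant time is
    admissible.  In a metric space such local thresholds are dominated by a
    continuous one: the supremum of the [e <= 1] such that all [e]-close points
    are good from time [1/e] on is a Lipschitz function of the point, and twice
    its inverse is a threshold ([continuous_threshold]).  This gives an admissible [alpha].

    If [w • w^*] and [b := w^* • w] lie in [V], then [w] is invertible for [•],
    and [w • theta b], its unitary part in the polar decomposition, is unitary
    because [theta b • theta b] inverts [b] ([unitary_part_unitary]).  It
    depends continuously on [(v, t)].  If [alpha] and [beta] are admissible,
    every time between [alpha v] and [beta v] is at least one of them, so the
    segment from [alpha] to [beta] stays in the range where the unitary part
    is defined; it provides the homotopy ([ftilde_homotopic]).  Uniqueness of
    the class then only uses that homotopy is symmetric and transitive. *)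

(** * The bullet operation *)

Section Algebra.
Context {R : realType} {A : smlcStarAlgType R}.
Implicit Types x y z : A.

Lemma amulx0 x : x ** 0 = 0.
Proof. by have := amulZr 0 x 0; rewrite !scale0r. Qed.

Lemma amul0x x : 0 ** x = 0.
Proof. by have := amulZl 0 0 x; rewrite !scale0r. Qed.

Lemma amulBl x y z : (x - y) ** z = x ** z - y ** z.
Proof. by rewrite amulDl -scaleN1r amulZl scaleN1r. Qed.

Lemma amulBr x y z : x ** (y - z) = x ** y - x ** z.
Proof. by rewrite amulDr -scaleN1r amulZr scaleN1r. Qed.

Lemma starB x y : star (x - y) = star x - star y.
Proof. by apply/eqP; rewrite -subr_eq opprK -starD subrK. Qed.

Lemma bulletx0 x : x • 0 = x.
Proof. by rewrite /bullet amulx0 !addr0. Qed.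

Lemma bullet0x x : 0 • x = x.
Proof. by rewrite /bullet amul0x add0r addr0. Qed.

Lemma bulletA : associative (@bullet R A).
Proof.
move=> x y z; rewrite /bullet !amulDl !amulDr amulA !addrA.
by rewrite [RHS](ACl (1*2*4*6*3*5*7))%AC/=.
Qed.

Lemma star_bullet x y : star (x • y) = star y • star x.
Proof. by rewrite /bullet !starD starM (addrC (star x)). Qed.

Lemma selfadjoint_bullet_star x : selfadjoint A (x • star x).
Proof. by rewrite /selfadjoint/= star_bullet starK. Qed.

Lemma bullet_continuous : continuous (fun p : A * A => p.1 • p.2).
Proof.
move=> p.
have c : (q.1 + q.2, q.1 ** q.2) @[q --> p] --> (p.1 + p.2, p.1 ** p.2).
  exact: cvg_pair (@add_continuous A p) (@amul_continuous _ A p).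
exact: cvg_comp c (@add_continuous A _).
Qed.

Lemma snormN n x : snorm n (- x) = snorm n x.
Proof. by rewrite -scaleN1r snormZ normcN Normc.normc1 mul1r. Qed.
End Algebra.

(** * Null families with respect to the seminorms *)

Section Limits.
Context {R : realType} {A : smlcStarAlgType R}.

Lemma cvg0P {T : Type} (F : set_system T) {FF : Filter F} (h : T -> A) :
  h x @[x --> F] --> (0 : A) <->
  forall n (e : R), 0 < e -> \forall x \near F, snorm n (h x) < e.
Proof.
split=> [h0 n e e0|H U /nbhs_snormE[n [e [e0 sU]]]].
  apply: (h0 [set y | snorm n y < e]); apply/nbhs_snormE; exists n, e.
  by split=> // y; rewrite /= subr0.
by apply: filterS (H n e e0) => x hx; apply: sU; rewrite /= subr0.
Qed.

Lemma nbhs_sdist_lt (x : A) (e : R) : 0 < e -> \forall y \near x, sdist x y < e.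
Proof. by move=> e0; apply/nbhs_sdistE; exists e. Qed.

Definition snorm_bounded_near {T : Type} (F : set_system T) (g : T -> A) :=
  forall n, exists M : R, \forall x \near F, snorm n (g x) <= M.

Context {T : Type} {F : set_system T} {FF : Filter F}.
Implicit Types g h : T -> A.

Lemma cvg0D g h : g x @[x --> F] --> (0 : A) -> h x @[x --> F] --> (0 : A) ->
  g x + h x @[x --> F] --> (0 : A).
Proof.
move=> /cvg0P g0 /cvg0P h0; apply/cvg0P => n e e0.
have e2 : 0 < e / 2 by rewrite divr_gt0.
near=> x; apply: le_lt_trans (snormD n _ _) _; rewrite (splitr e) ltrD//.
  by near: x; exact: g0.
by near: x; exact: h0.
Unshelve. all: by end_near. Qed.

Lemma cvg0_star g : g x @[x --> F] --> (0 : A) ->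
  star (g x) @[x --> F] --> (0 : A).
Proof.
move=> /cvg0P g0; apply/cvg0P => n e e0; apply: filterS (g0 n.+1 e e0) => x.
exact/le_lt_trans/snorm_star.
Qed.

Lemma cvg0_mul_bounded g h : snorm_bounded_near F g ->
  h x @[x --> F] --> (0 : A) ->
  g x ** h x @[x --> F] --> (0 : A) /\ h x ** g x @[x --> F] --> (0 : A).
Proof.
move=> gb /cvg0P h0.
have key n e : 0 < e ->
    \forall x \near F, snorm n.+1 (g x) * snorm n.+1 (h x) < e.
  move=> e0; have [M gM] := gb n.+1.
  have M0 : 0 < `|M| + 1 by rewrite ltr_wpDl.
  have eM : 0 < e / (`|M| + 1) by rewrite divr_gt0.
  near=> x; apply: (@le_lt_trans _ _ ((`|M| + 1) * snorm n.+1 (h x))).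
    rewrite ler_wpM2r ?snorm_ge0//.
    apply: (@le_trans _ _ M); first by near: x.
    by rewrite (le_trans (ler_norm _))// lerDl.
  by rewrite mulrC -ltr_pdivlMr//; near: x; exact: h0.
split; apply/cvg0P => n e e0; apply: filterS (key n e e0) => x.
  exact/le_lt_trans/snormM.
by rewrite mulrC; exact/le_lt_trans/snormM.
Unshelve. all: by end_near. Qed.

Lemma snorm_bounded_nearD g h : snorm_bounded_near F g ->
  snorm_bounded_near F h -> snorm_bounded_near F (fun x => g x + h x).
Proof.
move=> gb hb n; have [M gM] := gb n; have [N hN] := hb n.
exists (M + N); near=> x; apply: le_trans (snormD n _ _) _.
by apply: lerD; near: x.
Unshelve. all: by end_near. Qed.

Lemma snorm_bounded_near_star g : snorm_bounded_near F g ->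
  snorm_bounded_near F (fun x => star (g x)).
Proof.
move=> gb n; have [M gM] := gb n.+1; exists M; apply: filterS gM => x.
exact/le_trans/snorm_star.
Qed.

Lemma cvg0_snorm_bounded_near g : g x @[x --> F] --> (0 : A) ->
  snorm_bounded_near F g.
Proof.
by move=> /cvg0P g0 n; exists 1; apply: filterS (g0 n 1 ltr01) => x /ltW.
Qed.

(** Perturbing both factors of a null bullet product by null families keeps it
    null as soon as one old and one new factor are bounded, because
    [g • g' - h • h' = (g - h) + (g' - h') + g (g' - h') + (g - h) h']. *)
Lemma cvg0_bullet g g' h h' :
  snorm_bounded_near F g -> snorm_bounded_near F h' ->
  g x - h x @[x --> F] --> (0 : A) -> g' x - h' x @[x --> F] --> (0 : A) ->
  h x • h' x @[x --> F] --> (0 : A) -> g x • g' x @[x --> F] --> (0 : A).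
Proof.
move=> gb h'b gh g'h' hh'.
have [m1 _] := cvg0_mul_bounded gb g'h'.
have [_ m2] := cvg0_mul_bounded h'b gh.
have -> : (fun x => g x • g' x) = (fun x => h x • h' x +
    ((g x - h x) + (g' x - h' x) +
     (g x ** (g' x - h' x) + (g x - h x) ** h' x))).
  apply/funext => x; rewrite amulBr amulBl subrKA /bullet.
  rewrite (addrACA (g x)) -(opprD (h x)) [RHS]addrACA.
  by rewrite !(addrC _ (_ - _)) !subrK.
by apply: cvg0D => //; apply: cvg0D; apply: cvg0D.
Qed.

End Limits.

(** * Asymptotic behaviour on unitaries *)

Section Asymptotics.
Context {R : realType} {A B : smlcStarAlgType R} {f : R -> A -> B}.
Hypothesis hf : pbam f.

(* The argument tends to [a] and, independently, the time to infinity: limits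
   along this filter are the locally uniform ones. *)
Let asymp (a : A) : set_system (A * R) := filter_prod (nbhs a) (pinfty_nbhs R).

Lemma pbam_cvg0_sub a : f p.2 p.1 - f p.2 a @[p --> asymp a] --> (0 : B).
Proof.
move=> U /nbhs_sdistE[e e0 sU].
have [eta [P [eta0 P0 H]]] := pbam_asymptotic_continuity hf a e0.
exists ([set x | sdist a x < eta], [set t | P <= t]).
  by split; [exact: nbhs_sdist_lt | exact/nbhs_pinfty_ge/num_real].
move=> [x t] [/= ax Pt]; apply: sU => /=.
by rewrite -(sdist_translation _ _ (f t a)) add0r subrK; exact: H.
Qed.

(** Asymptotic homogeneity for the scalar [0]. *)
Lemma pbam_cvg0_0 : f t 0 @[t --> +oo] --> (0 : B).
Proof.
have /cvg0P H := pbam_scale hf 0 0; apply/cvg0P => n e e0.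
by apply: filterS (H n e e0) => t; rewrite !scale0r sub0r snormN.
Qed.

(** The defects of additivity at [(a, b)], of multiplicativity at [(a, b)] and
    of additivity at [(a + b, ab)] add up to [f_t(a) • f_t(b) - f_t(a • b)]. *)
Lemma pbam_cvg0_bullet a b : a • b = 0 ->
  f t a • f t b @[t --> +oo] --> (0 : B).
Proof.
move=> ab0.
have -> : (fun t => f t a • f t b) = (fun t =>
    (f t a + f t b - f t (a + b)) + (f t a ** f t b - f t (a ** b)) +
    ((f t (a + b) + f t (a ** b) - f t (a + b + a ** b)) + f t 0)).
  apply/funext => t; rewrite -[a + b + _]/(a • b) ab0 subrK /bullet.
  by rewrite (addrACA (f t a + f t b)) -opprD subrK.
apply: cvg0D; apply: cvg0D; [exact: pbam_add|exact: pbam_mul|exact: pbam_add|].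
exact: pbam_cvg0_0.
Qed.

Lemma pbam_snorm_bounded a b :
  snorm_bounded_near (asymp a) (fun p => f p.2 b).
Proof.
move=> n; have [M fM] := pbam_bounded hf b n; exists M.
exists (setT, [set t | 0 <= t]).
  by split; [exact: filterT | exact/nbhs_pinfty_ge/num_real].
by move=> [x t] [_ /= t0]; exact: fM.
Qed.

(** Along the joint filter [f_t(x)] may be replaced by [f_t(a)] and its adjoint
    by [f_t(a^* )], which reduces both limits to [pbam_cvg0_bullet]. *)
Lemma pbam_cvg0_unitary a : unitaries A a ->
  f p.2 p.1 • star (f p.2 p.1) @[p --> asymp a] --> (0 : B) /\
  star (f p.2 p.1) • f p.2 p.1 @[p --> asymp a] --> (0 : B).
Proof.
move=> [aas asa].
have fb : snorm_bounded_near (asymp a) (fun p => f p.2 p.1).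
  have -> : (fun p => f p.2 p.1) = (fun p => (f p.2 p.1 - f p.2 a) + f p.2 a).
    by apply/funext => p; rewrite subrK.
  apply: snorm_bounded_nearD (pbam_snorm_bounded a a).
  exact/cvg0_snorm_bounded_near/pbam_cvg0_sub.
have lim (h : R -> B) : h t @[t --> +oo] --> (0 : B) ->
    h p.2 @[p --> asymp a] --> (0 : B).
  by move=> h0; apply: cvg_comp h0; exact: cvg_snd.
have fs : star (f p.2 p.1) - f p.2 (star a) @[p --> asymp a] --> (0 : B).
  have -> : (fun p => star (f p.2 p.1) - f p.2 (star a)) = (fun p : A * R =>
      star (f p.2 p.1 - f p.2 a) + (star (f p.2 a) - f p.2 (star a))).
    by apply/funext => p; rewrite starB subrKA.
  apply: cvg0D; first exact/cvg0_star/pbam_cvg0_sub.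
  exact: lim (pbam_star hf a).
split.
- apply: (cvg0_bullet fb (pbam_snorm_bounded a (star a)) (pbam_cvg0_sub a) fs).
  exact: lim (pbam_cvg0_bullet aas).
- apply: (cvg0_bullet _ (pbam_snorm_bounded a a) fs (pbam_cvg0_sub a)).
    exact: snorm_bounded_near_star.
  exact: lim (pbam_cvg0_bullet asa).
Qed.

End Asymptotics.

(** * Continuous thresholds on metric spaces *)

Section Threshold.
Context {R : realType} {A : smlcStarAlgType R}.

Lemma sdist_ge0 (x y : A) : 0 <= sdist x y.
Proof.
have := sdist_triangle y x x.
by rewrite (sdist_eq0 x x).2// (sdist_sym y) -mulr2n pmulrn_lge0.
Qed.

Lemma lipschitz_continuous (s : A -> R) :
  (forall x y, s x <= s y + sdist x y) -> continuous s.
Proof.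
move=> sL x; apply/cvgrPdist_lt => e e0.
apply: filterS (nbhs_sdist_lt x e0) => y; apply: le_lt_trans.
rewrite ler_norml; have := sL x y; have := sL y x; rewrite (sdist_sym y).
by move=> ? ?; apply/andP; split; lra.
Qed.

(** A property that holds locally for all large times holds beyond a continuous
    threshold.  Let [s a] be the supremum of the [e <= 1] such that [G x t]
    holds whenever [x] is [e]-close to [a] and [t >= 1/e].  If [e] qualifies at
    [a] then [e - sdist a b] qualifies at [b], so [s] is Lipschitz; it is
    positive on [D], and [2 / s] is a threshold. *)
Lemma continuous_threshold (D : set A) (G : A -> R -> Prop) :
  (forall a, D a ->
    filter_prod (nbhs a) (pinfty_nbhs R) [set p | G p.1 p.2]) ->
  exists alpha : A -> R, [/\ {in D, continuous alpha}, forall a, 0 <= alpha a &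
    forall a t, D a -> alpha a <= t -> G a t].
Proof.
move=> DG.
pose S a := [set e : R | 0 <= e <= 1 /\
  (* [1 <= t * e] rather than [e^-1 <= t], to allow [e = 0] *)
  forall x t, sdist a x < e -> 1 <= t * e -> G x t].
have S0 a : S a 0 by split=> [|x t _]; rewrite ?lexx ?ler01// mulr0 ler10.
have Ssup a : has_sup (S a).
  by split; [exists 0 | exists 1 => e [/andP[]]].
pose s a := sup (S a).
have s_ge0 a : 0 <= s a by exact: ub_le_sup (Ssup a).2 _ (S0 a).
have sL a b : s a <= s b + sdist a b.
  apply: ge_sup; first exact: (Ssup a).1.
  move=> e [/andP[e0 e1] eG]; rewrite -lerBlDr.
  have [|de] := leP (e - sdist a b) 0; first by move=> /le_trans; apply.
  apply: ub_le_sup (Ssup b).2 _ _; split.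
    by rewrite (ltW de)/= lerBlDr (le_trans e1)// lerDl sdist_ge0.
  move=> x t bx t1; apply: eG.
    by rewrite (le_lt_trans (sdist_triangle b _ _))// -ltrBrDl.
  have t0 : 0 <= t by rewrite leNgt; apply/negP => t0; nra.
  rewrite (le_trans t1)// ler_wpM2l// lerBlDr lerDl; exact: sdist_ge0.
have sD a : D a -> 0 < s a.
  move=> Da; have [[P Q]/= [/nbhs_sdistE[r r0 rP] [M [_ MQ]]] PQG] := DG a Da.
  have [N N0 MN] : exists2 N, 0 < N & M < N.
    exists (`|M| + 1); first by rewrite ltr_wpDl.
    by rewrite (le_lt_trans (ler_norm M))// ltrDl.
  pose e := Num.min (Num.min r 1) N^-1.
  have e0 : 0 < e by rewrite !lt_min r0 ltr01 invr_gt0.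
  apply: (lt_le_trans e0); apply: ub_le_sup (Ssup a).2 _ _; split.
    by rewrite (ltW e0)/= !ge_min lexx orbT.
  move=> x t ax t1; apply: (PQG (x, t)); split => /=.
    by apply: rP; rewrite /= (lt_le_trans ax)// !ge_min lexx.
  apply: MQ; rewrite (lt_le_trans MN)// -(@ler_pM2r _ e)// (le_trans _ t1)//.
  by rewrite mulrC -ler_pdivlMr// mul1r ge_min lexx orbT.
exists (fun a => 2 / s a); split.
- move=> a /[!inE] Da; apply: cvgM; first exact: cvg_cst.
  by apply: cvgV; [rewrite gt_eqF// sD | exact: lipschitz_continuous].
- by move=> a; rewrite divr_ge0.
- move=> a t /sD sa; rewrite ler_pdivrMr// => st.
  (* the factor [2] leaves room for an [e] in [S a] close to its supremum *)
  have s2 : 0 < s a / 2 by rewrite divr_gt0.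
  have [e [/andP[e0 e1] eG] es] := sup_adherent s2 (Ssup a).
  have ee : s a / 2 < e by move: es; rewrite -/(s a); lra.
  apply: eG; first by rewrite (sdist_eq0 _ _).2// (lt_trans s2).
  nra.
Qed.

End Threshold.

(** * Homotopy as an equivalence relation *)

Section Homotopy.

Lemma continuous_within_comp {T U S : topologicalType} (D : set U)
    (F : U -> S) (q : T -> U) : {within D, continuous F} -> continuous q ->
  (forall x, D (q x)) -> continuous (F \o q).
Proof.
move=> /subspace_continuousP cF cq Dq x.
apply: cvg_comp (cF _ (Dq x)) => W WD.
apply: (@filterS _ (nbhs x) _ (fun y => D (q y) -> W (q y))); last exact: cq WD.
by move=> y; apply.
Qed.

Lemma continuous_pair_snd {X T U Y : topologicalType} (G : X * U -> Y)
    (r : T -> U) : continuous G -> continuous r ->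
  continuous (fun p : X * T => G (p.1, r p.2)).
Proof.
move=> cG cr p; have c2 : q.2 @[q --> p] --> p.2 by exact: cvg_snd.
have c : (q.1, r q.2) @[q --> p] --> (p.1, r p.2).
  by apply: cvg_pair; [exact: cvg_fst | exact: cvg_comp c2 (cr p.2)].
exact: cvg_comp c (cG _).
Qed.

Context {R : realType} {X Y : topologicalType}.

Lemma clampP (s : R) : Num.max 0 (Num.min 1 s) \in `[0, 1]%classic.
Proof. by rewrite inE /= in_itv/= le_max lexx ge_max ler01 ge_min lexx. Qed.

Definition clamp (s : R) : `[0, 1]%classic := SigSub (clampP s).

Lemma set_val_clamp (s : R) : 0 <= s <= 1 -> set_val (clamp s) = s.
Proof.
move=> /andP[s0 s1].
have -> : set_val (clamp s) = Num.max 0 (Num.min 1 s) by [].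
by rewrite min_r// max_r.
Qed.

Lemma clamp_continuous : continuous clamp.
Proof.
apply: continuous_comp_initial => s.
have cm : {for s, continuous ((cst 1 : R -> R^o) \min id)}.
  by apply: continuous_min; [exact: cvg_cst | exact: cvg_id].
have c0 : {for s, continuous (cst 0 : R -> R^o)} by exact: cvg_cst.
exact: continuous_max c0 cm.
Qed.

(** Precomposing with [clamp] extends the time of a homotopy to the whole line,
    where reparametrisations need no membership proofs. *)
Lemma homotopicP (g h : continuousType X Y) :
  homotopic R g h <-> exists G : X * R -> Y,
    [/\ continuous G, forall x, G (x, 0) = g x & forall x, G (x, 1) = h x].
Proof.
split=> [[H [cH H0 H1]]|[G [cG G0 G1]]].
  exists (fun p => H (p.1, clamp p.2)); split=> [|x|x] /=.
  - exact: (continuous_pair_snd cH clamp_continuous).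
  - by apply: H0; rewrite set_val_clamp// lexx ler01.
  - by apply: H1; rewrite set_val_clamp// lexx ler01.
exists (fun p => G (p.1, set_val p.2)); split=> [|x t /= ->|x t /= ->] //.
exact: (continuous_pair_snd cG (@initial_continuous _ _ set_val)).
Qed.

Lemma homotopic_sym (g h : continuousType X Y) :
  homotopic R g h -> homotopic R h g.
Proof.
move=> /homotopicP[G [cG G0 G1]]; apply/homotopicP.
exists (fun p => G (p.1, 1 - p.2)); split=> [|x|x]/=; last 2 first.
- by rewrite subr0.
- by rewrite subrr.
have cr : continuous (fun s : R => 1 - s).
  by move=> s; apply: cvgB; [exact: cvg_cst | exact: cvg_id].
exact: (continuous_pair_snd cG cr).
Qed.

Lemma homotopic_trans (g h k : continuousType X Y) :
  homotopic R g h -> homotopic R h k -> homotopic R g k.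
Proof.
move=> /homotopicP[G [cG G0 G1]] /homotopicP[H [cH H0 H1]].
apply/homotopicP.
(* the concatenation runs over [0, 2] and is rescaled at the end *)
pose K p := if p.2 <= 1 :> R then G p else H (p.1, p.2 - 1).
pose L := [set p : X * R | p.2 <= 1]; pose U := [set p : X * R | 1 <= p.2].
have KL p : L p -> G p = K p by rewrite /L/= => pL; rewrite /K pL.
have KU p : U p -> H (p.1, p.2 - 1) = K p.
  rewrite /U/= => pU; rewrite /K; case: ifPn => // p1.
  have p21 : p.2 = 1 by apply/eqP; rewrite eq_le p1.
  by rewrite p21 subrr H0 -G1 -p21 -surjective_pairing.
have cK : continuous K.
  have csnd : continuous (snd : X * R -> R) by move=> p; exact: cvg_snd.
  have LU : L `|` U = setT.
    by apply/seteqP; split=> // p _; apply/orP; exact: le_total.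
  apply/continuous_subspace_setT; rewrite -LU; apply: withinU_continuous.
  - exact: (closed_comp (fun p _ => csnd p) (@closed_le R 1)).
  - exact: (closed_comp (fun p _ => csnd p) (@closed_ge R 1)).
  - apply: (@subspace_eq_continuous _ _ _ G); last exact: continuous_subspaceT.
    by move=> p /[!inE]; exact: KL.
  - have cH1 : continuous (fun p : X * R => H (p.1, p.2 - 1)).
      have cr : continuous (fun s : R => s - 1).
        by move=> s; apply: cvgB; [exact: cvg_id | exact: cvg_cst].
      exact: (continuous_pair_snd cH cr).
    apply: (subspace_eq_continuous _ (continuous_subspaceT cH1)).
    by move=> p /[!inE]; exact: KU.
exists (fun p => K (p.1, 2 * p.2)); split=> [|x|x].
- have cr : continuous (fun s : R => 2 * s).
    by move=> s; apply: cvgM; [exact: cvg_cst | exact: cvg_id].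
  exact: (continuous_pair_snd cK cr).
- by rewrite /K/= mulr0 ler01 G0.
- have -> : K (x, 2 * 1) = H (x, 1); last by [].
  by rewrite /K/= ifN; [congr (H (_, _)); lra | rewrite -ltNge; lra].
Qed.

End Homotopy.

(** * Unitary parts *)

Section UnitaryPart.
Context {R : realType} {A B : smlcStarAlgType R} {V : set B} {theta : B -> B}.
Hypothesis hB : inverse_sqrt_data V theta.

(** The analogue of [w |w|^-1] in the polar decomposition. *)
Definition unitary_part (w : B) : B := w • theta (star w • w).

(** Put [c := theta (w^* • w)].  As [c • c • w^*] is a left inverse of [w], and
    [w] has a right inverse because [w • w^*] is invertible, both coincide;
    hence [w • c • c • w^* = 0]. *)
Lemma unitary_part_unitary w : V (w • star w) -> V (star w • w) ->
  unitaries B (unitary_part w).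
Proof.
move=> Vr Vl; rewrite /unitary_part; set b := star w • w; set c := theta b.
have cs : star c = c := isd_selfadjoint hB Vl.
have bc : b • c = c • b := isd_comm hB Vl.
have bcc : b • (c • c) = 0 := isd_inv_sqrt hB Vl.
have ccb : c • c • b = 0 by rewrite -bulletA -bc bulletA -bc -bulletA.
have [d [wwd _]] := isd_invertible hB Vr.
split; rewrite /= star_bullet cs; last first.
  by rewrite bulletA -[c • star w • w]bulletA -/b -bc -bulletA.
pose w' := c • c • star w.
have w'w : w' • w = 0 by rewrite -bulletA.
have wr : w • (star w • d) = 0 by rewrite bulletA.
have w'E : w' = star w • d.
  by rewrite -[w']bulletx0 -wr bulletA w'w bullet0x.
by rewrite -bulletA [c • _]bulletA -/w' w'E.
Qed.

Lemma unitary_part_continuous {T : topologicalType} (w : T -> B) :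
  continuous w -> (forall x, V (star (w x) • w x)) ->
  continuous (fun x => unitary_part (w x)).
Proof.
move=> cw Vw.
have cb (g h : T -> B) : continuous g -> continuous h ->
    continuous (fun x => g x • h x).
  move=> cg ch x; have c : (g y, h y) @[y --> x] --> (g x, h x).
    exact: cvg_pair (cg x) (ch x).
  exact: cvg_comp c (@bullet_continuous _ B _).
apply: (cb w) => //.
apply: (continuous_within_comp (isd_continuous hB)) => //.
by apply: cb => // x; exact: cvg_comp (cw x) (@star_continuous _ B _).
Qed.

Lemma star_bullet_near_V {T : Type} {F : set_system T} {FF : Filter F}
    (w : T -> B) : w x • star (w x) @[x --> F] --> (0 : B) ->
  \forall x \near F, V (w x • star (w x)).
Proof.
move=> w0; have [W oW VE] := isd_open hB.
have W0 : nbhs 0 W.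
  by apply: open_nbhs_nbhs; split=> //; have := isd_0 hB; rewrite VE => -[].
have : \forall x \near F, W (w x • star (w x)) by exact: (w0 _ W0).
apply: filterS => x Wx; rewrite VE; split => //.
exact: selfadjoint_bullet_star.
Qed.

(** * Admissible functions and the class they define *)

Context {f : R -> A -> B}.
Hypothesis hf : pbam f.

Lemma exists_admissible : exists alpha : unitaries A -> R, admissible V f alpha.
Proof.
pose G a t := V (f t a • star (f t a)) /\ V (star (f t a) • f t a).
have [a Ua|alpha [ca a0 aG]] := @continuous_threshold _ A (unitaries A) G.
  have [c1 c2] := pbam_cvg0_unitary hf Ua.
  apply: filterI; first exact: star_bullet_near_V c1.
  have c2' : star (f p.2 p.1) • star (star (f p.2 p.1))
      @[p --> filter_prod (nbhs a) (pinfty_nbhs R)] --> (0 : B).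
    by under eq_fun do rewrite starK.
  by apply: filterS (star_bullet_near_V c2') => p; rewrite starK.
exists (fun v => alpha (set_val v)); split=> [v|v|v t] //.
- exact: cvg_comp (@initial_continuous _ _ set_val v) (ca _ (valP v)).
- by apply: aG; exact: set_valP.
Qed.

(** The parameter space [T] serves twice: as the unitaries themselves, for
    [ftilde] at an admissible time, and as unitaries times the unit interval,
    for a homotopy between two admissible times. *)
Lemma lift_unitary_part {T : topologicalType}
    (v : T -> unitaries A) (s : T -> R) :
  continuous v -> continuous s -> (forall x, 0 <= s x) ->
  (forall x, V (f (s x) (set_val (v x)) • star (f (s x) (set_val (v x)))) /\
             V (star (f (s x) (set_val (v x))) • f (s x) (set_val (v x)))) ->
  exists2 g : T -> unitaries B, continuous g &
    forall x, set_val (g x) = unitary_part (f (s x) (set_val (v x))).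
Proof.
move=> cv cs s0 Vs.
pose w x := f (s x) (set_val (v x)).
have Uw x : unitary_part (w x) \in unitaries B.
  by rewrite inE; exact: unitary_part_unitary (Vs x).1 (Vs x).2.
exists (fun x => SigSub (Uw x)) => //.
apply: continuous_comp_initial.
apply: (@unitary_part_continuous _ w); last by move=> x; exact: (Vs x).2.
apply: (continuous_within_comp (q := fun x => (set_val (v x), s x))
   (pbam_continuous hf)) => // x.
apply: cvg_pair (cs x).
exact: cvg_comp (cv x) (@initial_continuous _ _ set_val (v x)).
Qed.

Lemma ftilde_continuousType alpha : admissible V f alpha ->
  exists g : continuousType (unitaries A) (unitaries B),
    forall v, set_val (g v) = ftilde theta f alpha v.
Proof.
move=> [ca a0 aV].
have cid : continuous (@id (unitaries A)) by move=> v; exact: cvg_id.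
have [v|g cg gE] := lift_unitary_part cid ca a0; first exact: aV.
by exists (mkcts cg).
Qed.

(** A convex combination of [alpha] and [beta] is at least their minimum, so it
    stays in the range covered by one of the two admissibility conditions. *)
Lemma ftilde_homotopic alpha beta
    (g h : continuousType (unitaries A) (unitaries B)) :
  admissible V f alpha -> admissible V f beta ->
  (forall v, set_val (g v) = ftilde theta f alpha v) ->
  (forall v, set_val (h v) = ftilde theta f beta v) ->
  homotopic R g h.
Proof.
move=> [ca a0 aV] [cb b0 bV] gE hE.
pose s (p : unitaries A * (`[0, 1]%classic : set R)) : R :=
  alpha p.1 + set_val p.2 * (beta p.1 - alpha p.1).
have s_ge p : alpha p.1 <= s p \/ beta p.1 <= s p.
  have : set_val p.2 \in `[0, 1]%classic by exact: valP.
  rewrite inE /= in_itv/= /s => /andP[t0 t1].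
  by have [ab|ba] := leP (alpha p.1) (beta p.1); [left|right]; nra.
have cfst : continuous (fst : unitaries A * (`[0, 1]%classic : set R) -> _).
  by move=> p; exact: cvg_fst.
have cs : continuous s.
  move=> p; have cf : q.1 @[q --> p] --> p.1 by exact: cvg_fst.
  have ca1 : alpha q.1 @[q --> p] --> alpha p.1 by exact: cvg_comp cf (ca p.1).
  have cb1 : beta q.1 @[q --> p] --> beta p.1 by exact: cvg_comp cf (cb p.1).
  have c2 : set_val q.2 @[q --> p] --> set_val p.2.
    have c2 : q.2 @[q --> p] --> p.2 by exact: cvg_snd.
    exact: cvg_comp c2 (@initial_continuous _ _ set_val p.2).
  by apply: cvgD => //; apply: cvgM => //; apply: cvgB.
have s0 p : 0 <= s p by case: (s_ge p); exact: le_trans.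
have [p|G cG GE] := lift_unitary_part cfst cs s0.
  by case: (s_ge p); [exact: aV|exact: bV].
exists G; split=> // v t t01; apply: val_inj; rewrite [LHS]GE /s/= t01.
  by rewrite mul0r addr0 [RHS]gE.
by rewrite mul1r addrC subrK [RHS]hE.
Qed.
End UnitaryPart.

Theorem proposition5p3 (R : realType) (A B : smlcStarAlgType R)
    (V : set B) (theta : B -> B) (hB : inverse_sqrt_data V theta)
    (f : R -> A -> B) (hf : pbam f) :
  (exists alpha : unitaries A -> R, admissible V f alpha) /\
  exists! c : set (continuousType (unitaries A) (unitaries B)),
    homotopy_classes R (unitaries A) (unitaries B) c /\
    forall alpha : unitaries A -> R, admissible V f alpha ->
      exists2 g : continuousType (unitaries A) (unitaries B),
        c g & forall v, set_val (g v) = ftilde theta f alpha v.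
Proof.
have [alpha0 adm0] := exists_admissible hB hf; split; first by exists alpha0.
have [g0 g0E] := ftilde_continuousType hB hf adm0.
exists [set h | homotopic R g0 h]; split.
  split=> [|alpha adm]; first by exists g0.
  have [g gE] := ftilde_continuousType hB hf adm; exists g => //.
  by rewrite /=; exact: (ftilde_homotopic hB hf adm0 adm g0E gE).
move=> c [[k ->] /(_ alpha0 adm0)[g /= kg gE]].
have gg0 : g = g0.
  apply/continuousEP => v; apply: val_inj.
  exact: etrans (gE v) (esym (g0E v)).
move: kg; rewrite {}gg0 => kg0.
apply/seteqP; split=> h /=; first exact: homotopic_trans.
by apply: homotopic_trans; exact: homotopic_sym.
Qed.
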